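(* Let $a<b$ be real numbers, let $M\colon[a,b]\to\mathbb{R}$ be non-decreasing, and let $N\colon[M(a),M(b)]\to\mathbb{R}$ be non-decreasing. Let \[H=\{y\in[M(a),M(b)] : M^{-1}[\{y\}]\text{ contains more than one point}\}\] (a countable set), and define $X,\Xi\colon[M(a),M(b)]\to[a,b]$ by $X(y)=\inf\{x\in[a,b]: y\le M(x)\}$ and $\Xi(y)=\sup\{x\in[a,b]: M(x)\le y\}$. For $y\in H$ let $\Delta N(y,-)=N(y)-N(y-)$ and $\Delta N(y,+)=N(y+)-N(y)$ (with the conventions $N(M(a)-)=N(M(a))$ and $N(M(b)+)=N(M(b))$), and let \[N_1=N-\sum_{y\in H}\Big(\Delta N(y,-)\,\mathbf 1_{[y,M(b)]}+\Delta N(y,+)\,\mathbf 1_{(y,M(b)]}\Big),\] the non-decreasing function obtained from $N$ by removing its jumps at the points of $H$. Then for each bounded Borel function $f\colon[a,b]\to\mathbb{R}$, \[\int_a^b f(x)\,dN(M(x))=\int_{M(a)}^{M(b)} f(X(y))\,dN_1(y)+\sum_{y\in H} f(X(y))\,\Delta N(y,-)+\sum_{y\in H} f(\Xi(y))\,\Delta N(y,+).\] Furthermore, the same identity holds with $X$ replaced by $\Xi$ in the first term on the right-hand side, i.e. $\int_{M(a)}^{M(b)} f(X(y))\,dN_1(y)=\int_{M(a)}^{M(b)} f(\Xi(y))\,dN_1(y)$.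
   Context: ''Non-decreasing'' is what the paper calls increasing. For a non-decreasing function $F\colon[c,d]\to\mathbb{R}$, the measure corresponding to $F$ is the unique Borel measure $\mu$ on $[c,d]$ such that for every continuous $f\colon[c,d]\to\mathbb{R}$, $\int_{[c,d]} f\,d\mu$ equals the Riemann–Stieltjes integral $\int_c^d f(x)\,dF(x)$. For a bounded Borel function $f$, the Lebesgue–Stieltjes integral $\int_c^d f(x)\,dF(x)$ is defined as $\int_{[c,d]} f\,d\mu$. The notation $\int_a^b f(x)\,dN(M(x))$ means $\int_a^b f(x)\,d\Lambda(x)$ with $\Lambda=N\circ M$. The sum defining $N_1$ converges uniformly since the jumps are summable. *)

(* Defs.v *)
From HB Require Import structures.
From mathcomp Require Import all_boot all_order all_algebra.
From mathcomp Require Import all_classical all_reals all_analysis.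
Set Implicit Arguments. Unset Strict Implicit. Unset Printing Implicit Defensive.
Import Order.TTheory GRing.Theory Num.Theory.
Import numFieldNormedType.Exports.
Local Open Scope classical_set_scope.
Local Open Scope ring_scope.

Section Defs.
Variable R : realType.

Definition RS_integral (F f : R -> R) (c d I : R) : Prop :=
  forall e : R, 0 < e -> exists2 delta : R, 0 < delta &
    forall (n : nat) (p t : nat -> R),
      p 0%N = c -> p n = d ->
      (forall i, (i < n)%N -> p i <= t i <= p i.+1) ->
      (forall i, (i < n)%N -> p i.+1 - p i < delta) ->
      `| \sum_(i < n) f (t i) * (F (p i.+1) - F (p i)) - I | < e.

Definition is_LS_measure (F : R -> R) (c d : R)
    (mu : {measure set R -> \bar R}) : Prop :=
  forall f : R -> R, {within `[c, d], continuous f} ->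
    exists I : R, RS_integral F f c d I /\
      (\int[mu]_(x in `[c, d]%classic) (f x)%:E = I%:E)%E.

(* Sum of a (absolutely summable) real family over a set H, as an extended
   real: sum of positive parts minus sum of negative parts. *)
Definition sum_over (H : set R) (g : R -> R) : \bar R :=
  (\esum_(y in H) (g^\+ y)%:E - \esum_(y in H) (g^\- y)%:E)%E.

Definition left_lim (N : R -> R) (c y : R) : R :=
  if y == c then N c else lim (N x @[x --> y^'-]).
Definition right_lim (N : R -> R) (d y : R) : R :=
  if y == d then N d else lim (N x @[x --> y^'+]).

Definition jump_minus (N : R -> R) (c y : R) : R := N y - left_lim N c y.
Definition jump_plus (N : R -> R) (d y : R) : R := right_lim N d y - N y.

Definition Hset (a b : R) (M : R -> R) : set R :=
  [set y | `[M a, M b]%classic y /\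
     exists x1 x2, [/\ x1 != x2, `[a, b]%classic x1, `[a, b]%classic x2, M x1 = y & M x2 = y]].

Definition Xf (a b : R) (M : R -> R) (y : R) : R :=
  inf [set x | `[a, b]%classic x /\ y <= M x].
Definition Xif (a b : R) (M : R -> R) (y : R) : R :=
  sup [set x | `[a, b]%classic x /\ M x <= y].

Definition indic (A : set R) (y : R) : R := if `[< A y >] then 1 else 0.

Definition N1 (a b : R) (M N : R -> R) (y : R) : R :=
  N y - fine (sum_over (Hset a b M) (fun h =>
      jump_minus N (M a) h * indic `[h, M b]%classic y
    + jump_plus N (M b) h * indic `]h, M b]%classic y)).

End Defs.

(* Main.v *)
Require Import Defs.
From HB Require Import structures.
From mathcomp Require Import all_boot all_order all_algebra.
From mathcomp Require Import all_classical all_reals all_analysis.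
From mathcomp Require Import measurable_realfun ring lra.
Import Order.TTheory GRing.Theory Num.Theory.
Import numFieldNormedType.Exports.
Local Open Scope classical_set_scope.
Local Open Scope ring_scope.

(** Let [c = M a], [d = M b]. A measure attached to a non-decreasing [F] is
    determined on [[c, d]] by the squeeze [mu [c, u] <= F v - F c] and
    [F u - F c <= mu [c, v[] for [u < v], together with its total mass; testing
    the Stieltjes integral against piecewise linear cutoffs gives it. Hence it
    is enough to see that
      [rho = X_* mu1 + sum_(y in H) (Delta N(y,-) delta_(X y) + Delta N(y,+) delta_(Xi y))]
    satisfies the squeeze for [N o M]. For [x < x'], [X y <= x] forces
    [y <= M x'] and [Xi y <= x] forces [y < M x'], so the atoms contribute at
    most [(N - N1) (M x')] to [rho [a, x]]. The [mu1]-part is compared with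
    [N1] through a point strictly between [x] and [x']: either [M] increases
    there and the squeeze for [mu1] applies, or [M] takes a value in [H], where
    [N1] is continuous. The lower bound is symmetric. Finally [X] and [Xi]
    differ only on [H], a countable set of [mu1]-null points. *)

Set Implicit Arguments.
Unset Strict Implicit.
Unset Printing Implicit Defensive.

(** * Stieltjes sums, cutoffs and the squeeze on distribution functions *)

Section RiemannStieltjes.
Variable R : realType.
Implicit Types (F G f : R -> R) (c d u v x y I : R).

Lemma uniform_partition (c d delta : R) : c <= d -> 0 < delta ->
  exists n (p : nat -> R),
    [/\ p 0%N = c, p n = d,
        forall i, (i < n)%N -> [/\ c <= p i, p i <= p i.+1 & p i.+1 <= d]
      & forall i, (i < n)%N -> p i.+1 - p i < delta].
Proof.
(* The successor of the truncation exceeds [(d - c) / delta] strictly, so equal steps are shorter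
   than [delta]; it is positive even when [c = d]. *)
move=> cd delta0; pose n := (Num.truncn ((d - c) / delta)).+1.
have n0 : 0 < n%:R :> R by rewrite ltr0n.
pose h := (d - c) / n%:R.
have h0 : 0 <= h by rewrite divr_ge0 ?subr_ge0// ltW.
exists n, (fun i => c + i%:R * h); split.
- by rewrite mul0r addr0.
- by rewrite /h mulrC divfK ?gt_eqF// addrC subrK.
- move=> i ilt; split.
  + by rewrite lerDl mulr_ge0.
  + by rewrite lerD2l ler_wpM2r// ler_nat.
  + have -> : d = c + n%:R * h by rewrite /h mulrC divfK ?gt_eqF// addrC subrK.
    by rewrite lerD2l ler_wpM2r// ler_nat.
- move=> i ilt; rewrite -natr1 mulrDl mul1r opprD addrACA subrr add0r.
  rewrite addrAC subrr add0r /h ltr_pdivrMr// mulrC -ltr_pdivrMr//.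
  exact: truncnS_gt.
Qed.

Lemma telescope_ord (g : nat -> R) n : \sum_(i < n) (g i.+1 - g i) = g n - g 0%N.
Proof. by rewrite -(telescope_sumr g (leq0n n)) big_mkord. Qed.

(* Right tags bound the integral from above, left tags from below. *)
Lemma RS_integral_le F f G c d I : c <= d -> RS_integral F f c d I ->
  (forall x y, c <= x -> x <= y -> y <= d -> f y * (F y - F x) <= G y - G x) ->
  I <= G d - G c.
Proof.
move=> cd HI HG; apply/ler_addgt0Pr => e e0.
have [delta delta0 H] := HI e e0.
have [n [p [p0 pn pmono pmesh]]] := uniform_partition cd delta0.
have /ltr_normlP[+ _] := H n p (fun i => p i.+1) p0 pn
   (fun i ilt => let: And3 _ h _ := pmono i ilt in introT andP (conj h (lexx _)))
   pmesh.
have : \sum_(i < n) f (p i.+1) * (F (p i.+1) - F (p i)) <= G d - G c.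
  rewrite -pn -p0 -(telescope_ord (G \o p)); apply: ler_sum => i _.
  by have [? ? ?] := pmono _ (ltn_ord i); exact: HG.
by rewrite opprB; lra.
Qed.

Lemma RS_integral_ge F f G c d I : c <= d -> RS_integral F f c d I ->
  (forall x y, c <= x -> x <= y -> y <= d -> G y - G x <= f x * (F y - F x)) ->
  G d - G c <= I.
Proof.
move=> cd HI HG; apply/ler_addgt0Pr => e e0.
have [delta delta0 H] := HI e e0.
have [n [p [p0 pn pmono pmesh]]] := uniform_partition cd delta0.
have /ltr_normlP[_] := H n p p p0 pn
   (fun i ilt => let: And3 _ h _ := pmono i ilt in introT andP (conj (lexx _) h))
   pmesh.
have : G d - G c <= \sum_(i < n) f (p i) * (F (p i.+1) - F (p i)).
  rewrite -pn -p0 -(telescope_ord (G \o p)); apply: ler_sum => i _.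
  by have [? ? ?] := pmono _ (ltn_ord i); exact: HG.
by lra.
Qed.

(** For [u < v], a continuous function lying between the indicators of the half-lines up to [u] and
    below [v]: 1 up to [u], 0 from [v] on, linear between. *)
Definition cutoff u v x : R := Num.max 0 (Num.min 1 ((v - x) / (v - u))).

Lemma cutoff_ge0 u v x : 0 <= cutoff u v x.
Proof. by rewrite /cutoff le_max lexx. Qed.

Lemma cutoff_le1 u v x : cutoff u v x <= 1.
Proof. by rewrite /cutoff ge_max ler01 ge_min lexx. Qed.

Lemma cutoff1 u v x : u < v -> x <= u -> cutoff u v x = 1.
Proof.
move=> uv xu; rewrite /cutoff min_l ?max_r//.
by rewrite ler_pdivlMr ?subr_gt0// mul1r lerD2l lerN2.
Qed.

Lemma cutoff0 u v x : u < v -> v <= x -> cutoff u v x = 0.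
Proof.
move=> uv vx; rewrite /cutoff max_l// ge_min; apply/orP; right.
by rewrite ler_pdivrMr ?subr_gt0// mul0r subr_le0.
Qed.

Lemma continuous_cutoff u v : continuous (cutoff u v).
Proof.
move=> x; apply: (@continuous_max R R (cst 0) _ x); first exact: cst_continuous.
apply: (@continuous_min R R (cst 1) _ x); first exact: cst_continuous.
by apply: cvgM; [apply: cvgB; [exact: cvg_cst|exact: cvg_id]|exact: cvg_cst].
Qed.

(* The distribution function of [mu] squeezed between values of [F]; it
   pins [mu] down on [[c, d]] without mentioning one-sided limits of [F]. *)
Definition LS_squeeze F c d (mu : set R -> \bar R) : Prop :=
  [/\ mu `[c, d]%classic = (F d - F c)%:E,
      forall u v, c <= u -> u < v -> v <= d ->
        (mu `[c, u]%classic <= (F v - F c)%:E)%E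
    & forall u v, c <= u -> u < v -> v <= d ->
        ((F u - F c)%:E <= mu `[c, v[%classic)%E].

(** On [[c, d]] the cutoff dominates the indicator of [[c, u]] and is dominated by that of [[c, v[],
    while its Stieltjes integral lies between [F u - F c] and [F v - F c]. *)
Lemma is_LS_measure_squeeze F c d (mu : {measure set R -> \bar R}) : c <= d ->
  {in `[c, d]%classic &, {homo F : x y / x <= y}} ->
  is_LS_measure F c d mu -> LS_squeeze F c d mu.
Proof.
move=> cd ndF HF.
have ndF' x y : c <= x -> x <= y -> y <= d -> F x <= F y.
  move=> cx xy yd; apply: ndF => //; rewrite inE/= in_itv/= ?cx ?yd ?andbT//.
    exact: le_trans yd.
  exact: le_trans xy.
have mcd : measurable `[c, d]%classic by exact: measurable_itv.
have Icut u v : c <= u -> u < v -> v <= d -> exists I,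
    [/\ F u - F c <= I, I <= F v - F c &
      (\int[mu]_(x in `[c, d]%classic) (cutoff u v x)%:E = I%:E)%E].
  move=> cu uv vd.
  have [I [HI intI]] := HF (cutoff u v)
    (continuous_subspaceT (@continuous_cutoff u v)).
  exists I; split => //.
  (* Compare with [F] stopped at [u]: a left tag [x <= u] has cutoff 1, and beyond [u] the stopped
     increments vanish. *)
  - have := RS_integral_ge (G := (fun x => F (Num.min x u))) cd HI.
    rewrite /= (min_r (ltW (lt_le_trans uv vd))) (min_l cu); apply => x y cx xy yd.
    have [xu|ux] := leP x u.
      rewrite cutoff1// mul1r lerD2r; apply: ndF' => //.
        by rewrite le_min cu (le_trans cx).
      by rewrite ge_min lexx.
    rewrite min_r ?subrr ?mulr_ge0 ?cutoff_ge0 ?subr_ge0 ?ndF'//.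
    exact: le_trans (ltW ux) xy.
  (* Compare with [F] stopped at [v]: a right tag [y >= v] has cutoff 0, so an interval straddling
     [v] contributes nothing. *)
  - have := RS_integral_le (G := (fun x => F (Num.min x v))) cd HI.
    rewrite /= (min_r vd) (min_l (le_trans cu (ltW uv))); apply => x y cx xy yd.
    have [yv|vy] := ltP y v.
      rewrite (min_l (le_trans xy (ltW yv))).
      by rewrite ler_piMl ?cutoff_le1// subr_ge0 ndF'.
    rewrite cutoff0// mul0r subr_ge0; apply: ndF' => //.
      by rewrite le_min cx (le_trans cu (ltW uv)).
    by rewrite ge_min lexx orbT.
have mcut u v : measurable_fun `[c, d]%classic (fun x => (cutoff u v x)%:E).
  apply/measurable_EFinP/measurable_funTS; apply: continuous_measurable_fun.
  exact: continuous_cutoff.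
split.
(* The constant 1 gives the total mass exactly, since both comparisons hold with [G := F]. *)
- have cst1 : {within `[c, d], continuous (cst (1 : R))}.
    by apply: continuous_subspaceT => x; exact: cvg_cst.
  have [I [HI intI]] := HF (cst 1) cst1.
  move: intI; rewrite /= integral_cst// mul1e => ->; congr _%:E; apply/eqP.
  rewrite eq_le; apply/andP; split.
    by apply: (RS_integral_le (G := F) cd HI) => *; rewrite mul1r.
  by apply: (RS_integral_ge (G := F) cd HI) => *; rewrite mul1r.
- move=> u v cu uv vd; have [I [_ Iv intI]] := Icut _ _ cu uv vd.
  apply: (@le_trans _ _ I%:E); last by rewrite lee_fin.
  have <- : `[c, u]%classic `&` `[c, d]%classic = `[c, u]%classic.
    apply: setIidl; apply: subset_itvl; rewrite bnd_simp.
    exact: le_trans (ltW uv) vd.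
  rewrite -intI -(integral_indic mu mcd (measurable_itv `[c, u])).
  apply: ge0_le_integral => //.
  + by apply/measurable_EFinP; apply: measurable_indic; exact: measurable_itv.
  + move=> x _; rewrite lee_fin indicE.
    case: (boolP (x \in _)) => [|_]/=; last exact: cutoff_ge0.
    by rewrite inE/= in_itv/= => /andP[_ xu]; rewrite cutoff1.
- move=> u v cu uv vd; have [I [uI _ intI]] := Icut _ _ cu uv vd.
  apply: (@le_trans _ _ I%:E); first by rewrite lee_fin.
  have <- : `[c, v[%classic `&` `[c, d]%classic = `[c, v[%classic.
    by apply: setIidl; apply: subset_itvl; rewrite bnd_simp.
  rewrite -intI -(integral_indic mu mcd (measurable_itv `[c, v[)).
  apply: ge0_le_integral => //.
  + by move=> x _; rewrite lee_fin cutoff_ge0.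
  + by apply/measurable_EFinP; apply: measurable_indic; exact: measurable_itv.
  + move=> x /=; rewrite in_itv/= => /andP[cx _].
    rewrite lee_fin indicE; have [xv|vx] := ltP x v.
      by rewrite mem_set/= ?cutoff_le1// in_itv/= cx.
    by rewrite cutoff0.
Qed.

End RiemannStieltjes.

(** * The squeeze determines the measure on [[c, d]] *)

Section Uniqueness.
Variable R : realType.
Implicit Types (F : R -> R) (c d w : R) (m : {measure set R -> \bar R}).

(** Exhaust [[c, w[] by closed intervals [[c, u]] with [u < w]. At a point [v] between [u] and [w],
    the value [F v - F c] bounds [m1] of [[c, u]] from above and [m2] of [[c, w[] from below. *)
Lemma LS_squeeze_le F c d m1 m2 w : LS_squeeze F c d m1 -> LS_squeeze F c d m2 ->
  c < w -> w <= d -> (m1 `[c, w[%classic <= m2 `[c, w[%classic)%E.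
Proof.
move=> [_ m1le _] [_ _ m2ge] cw wd.
rewrite {1}itv_bnd_open_bigcup.
set I := fun n : nat => `[c, w - n.+1%:R^-1]%classic.
have mI n : measurable (I n) by exact: measurable_itv.
have ndI : {homo I : n k / (n <= k)%N >-> (n <= k)%O}.
  move=> n k nk; apply/subsetPset; apply: subset_itvl; rewrite bnd_simp.
  by rewrite lerD2l lerN2 lef_pV2 ?posrE ?ltr0n// ler_nat ltnS.
have cvgI := @nondecreasing_cvg_mu _ _ _ m1 I mI (bigcupT_measurable _ mI) ndI.
rewrite -(cvg_lim _ cvgI)//; apply: lime_le; first by apply/cvg_ex; eexists; exact: cvgI.
apply: nearW => n /=; set u := w - n.+1%:R^-1.
have uw : u < w by rewrite ltrBlDr ltrDl invr_gt0 ltr0n.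
(* For small [n] the endpoint [u] may fall below [c]; the interval is then empty. *)
have [cu|uc] := leP c u; last by rewrite /I set_itv_ge ?measure0// bnd_simp -ltNge.
have [uv vw] : u < (u + w) / 2 /\ (u + w) / 2 < w by split; lra.
apply: le_trans (m1le _ _ cu uv (le_trans (ltW vw) wd)) _.
by apply: m2ge => //; rewrite (le_trans cu)// ltW.
Qed.

(** Open left half-lines form a generating pi-system. Their traces on [[c, d]] are empty, some [[c,
    x[], or all of [[c, d]], and the two measures agree on each, by [LS_squeeze_le] both ways or by
    the total mass. *)
Lemma LS_squeeze_unique F c d m1 m2 : LS_squeeze F c d m1 -> LS_squeeze F c d m2 ->
  forall A, measurable A -> A `<=` `[c, d]%classic -> m1 A = m2 A.
Proof.
move=> H1 H2 A mA Acd.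
have mcd : measurable `[c, d]%classic by exact: measurable_itv.
have [m1cd _ _] := H1; have [m2cd _ _] := H2.
suff : mrestr m1 mcd A = mrestr m2 mcd A by rewrite /mrestr (setIidl Acd).
apply: (measure_unique (@RGenInftyO.G R) (fun n => `]-oo, n%:R[%classic)) => //.
- exact: RGenInftyO.measurableE.
- move=> _ _ [x ->] [y ->]; exists (Num.min x y); apply/seteqP; split => z /=.
    by rewrite !in_itv/= lt_min => -[-> ->].
  by rewrite !in_itv/= lt_min => /andP[-> ->].
- by move=> n; exists n%:R.
- rewrite -subTset => x _; exists (Num.truncn x).+1 => //=.
  by rewrite in_itv/=; exact: truncnS_gt.
- move=> _ [x ->]; rewrite /= /mrestr.
  have [xc|cx] := leP x c.
    rewrite (_ : _ `&` _ = set0) ?measure0// -subset0 => z /=.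
    rewrite !in_itv/= => -[zx /andP[cz _]].
    by have := lt_le_trans zx (le_trans xc cz); rewrite ltxx.
  have [xd|dx] := leP x d.
    rewrite (_ : _ `&` _ = `[c, x[%classic); last first.
      apply/seteqP; split => z /=; rewrite !in_itv/=.
        by move=> [-> /andP[->]].
      by move=> /andP[-> zx]; rewrite zx (le_trans (ltW zx)).
    by apply/eqP; rewrite eq_le (LS_squeeze_le H1 H2)// (LS_squeeze_le H2 H1).
  rewrite (_ : _ `&` _ = `[c, d]%classic) ?m1cd// setIidr// => z /=.
  by rewrite !in_itv/= => /andP[_ /le_lt_trans]; exact.
- move=> n; rewrite /= /mrestr.
  apply: (@le_lt_trans _ _ (m1 `[c, d]%classic)); last by rewrite m1cd ltry.
  by rewrite le_measure ?inE//; exact: measurableI.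
Qed.

End Uniqueness.

(** * One-sided limits and jump sums of a non-decreasing function *)

Section Jumps.
Variables (R : realType) (c d : R) (N : R -> R).
Hypothesis ndN : {in `[c, d]%classic &, {homo N : x y / x <= y}}.
Implicit Types (u v x y h e : R) (s : seq R) (H : set R).

Let ndN' x y : c <= x -> x <= y -> y <= d -> N x <= N y.
Proof.
move=> cx xy yd; apply: ndN => //; rewrite inE/= in_itv/= ?cx ?yd ?andbT//.
  exact: le_trans yd.
exact: le_trans xy.
Qed.

(** Monotonicity and the bound [N y] make the limit exist, so the [lim] in [left_lim] is a genuine
    limit and not a default value. *)
Lemma left_lim_cvg y : c < y -> y <= d -> N x @[x --> y^'-] --> left_lim N c y.
Proof.
move=> cy yd; rewrite /left_lim gt_eqF//.
apply: nondecreasing_at_left_is_cvgr.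
- near=> x => u v; rewrite !in_itv/= => /andP[xu uy] /andP[xv vy] uv.
  apply: ndN' => //; last exact: le_trans (ltW vy) yd.
  by apply: le_trans (ltW xu); near: x; exact: nbhs_left_ge.
- near=> x; exists (N y) => _ /= [z + <-]; rewrite in_itv/= => /andP[xz zy].
  apply: ndN' => //; last exact: ltW.
  by apply: le_trans (ltW xz); near: x; exact: nbhs_left_ge.
Unshelve. all: by end_near. Qed.

Lemma right_lim_cvg y : c <= y -> y < d -> N x @[x --> y^'+] --> right_lim N d y.
Proof.
move=> cy yd; rewrite /right_lim lt_eqF//.
apply: nondecreasing_at_right_is_cvgr.
- near=> x => u v; rewrite !in_itv/= => /andP[yu ux] /andP[yv vx] uv.
  apply: ndN' => //; first exact: le_trans cy (ltW yu).
  by apply: le_trans (ltW vx) _; near: x; exact: nbhs_right_le.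
- near=> x; exists (N y) => _ /= [z + <-]; rewrite in_itv/= => /andP[yz zx].
  apply: ndN' => //; first exact: ltW.
  by apply: le_trans (ltW zx) _; near: x; exact: nbhs_right_le.
Unshelve. all: by end_near. Qed.

Lemma le_left_lim u y : c <= u -> u < y -> y <= d -> N u <= left_lim N c y.
Proof.
move=> cu uy yd; have cv := left_lim_cvg (le_lt_trans cu uy) yd.
rewrite -(cvg_lim _ cv)//; apply: limr_ge; first by apply/cvg_ex; eexists; exact: cv.
near=> x; apply: ndN' => //; first by near: x; exact: nbhs_left_ge.
by apply: le_trans yd; near: x; exact: nbhs_left_le.
Unshelve. all: by end_near. Qed.

Lemma left_lim_le y : c <= y -> y <= d -> left_lim N c y <= N y.
Proof.
rewrite le_eqVlt => /predU1P[<- _|cy yd]; first by rewrite /left_lim eqxx.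
have cv := left_lim_cvg cy yd.
rewrite -(cvg_lim _ cv)//; apply: limr_le; first by apply/cvg_ex; eexists; exact: cv.
by near=> x; apply: ndN' => //; near: x; exact: nbhs_left_ge.
Unshelve. all: by end_near. Qed.

Lemma left_lim_adherent y e : c < y -> y <= d -> 0 < e ->
  exists u, [/\ c <= u, u < y & left_lim N c y <= N u + e].
Proof.
move=> cy yd e0; have /cvgrPdist_le/(_ e e0) cv := left_lim_cvg cy yd.
near y^'- => u; exists u; split; first by near: u; exact: nbhs_left_ge.
  by near: u; exact: nbhs_left_lt.
have /ler_normlP[_] : `|left_lim N c y - N u| <= e by near: u.
by rewrite lerBlDl.
Unshelve. all: by end_near. Qed.

Lemma right_lim_le y v : c <= y -> y < v -> v <= d -> right_lim N d y <= N v.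
Proof.
move=> cy yv vd; have cv := right_lim_cvg cy (lt_le_trans yv vd).
rewrite -(cvg_lim _ cv)//; apply: limr_le; first by apply/cvg_ex; eexists; exact: cv.
near=> x; apply: ndN' => //; last by near: x; exact: nbhs_right_le.
by apply: le_trans cy _; near: x; exact: nbhs_right_ge.
Unshelve. all: by end_near. Qed.

Lemma le_right_lim y : c <= y -> y <= d -> N y <= right_lim N d y.
Proof.
move=> cy; rewrite le_eqVlt => /predU1P[->|yd]; first by rewrite /right_lim eqxx.
have cv := right_lim_cvg cy yd.
rewrite -(cvg_lim _ cv)//; apply: limr_ge; first by apply/cvg_ex; eexists; exact: cv.
by near=> x; apply: ndN' => //; near: x; exact: nbhs_right_le.
Unshelve. all: by end_near. Qed.

Lemma right_lim_adherent y e : c <= y -> y < d -> 0 < e ->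
  exists v, [/\ y < v, v <= d & N v <= right_lim N d y + e].
Proof.
move=> cy yd e0; have /cvgrPdist_le/(_ e e0) cv := right_lim_cvg cy yd.
near y^'+ => v; exists v; split; last 1 first.
- have /ler_normlP[+ _] : `|right_lim N d y - N v| <= e by near: v.
  by rewrite opprB lerBlDl.
- by near: v; exact: nbhs_right_gt.
- by near: v; exact: nbhs_right_le.
Unshelve. all: by end_near. Qed.

Lemma jump_minus_ge0 y : c <= y -> y <= d -> 0 <= jump_minus N c y.
Proof. by move=> cy yd; rewrite subr_ge0 left_lim_le. Qed.

Lemma jump_plus_ge0 y : c <= y -> y <= d -> 0 <= jump_plus N d y.
Proof. by move=> cy yd; rewrite subr_ge0 le_right_lim. Qed.

(* The part of the jump of [N] at [h] that is seen by [N v - N u]. *)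
Definition jump_in u v h : R :=
  jump_minus N c h * (u < h <= v)%R%:R + jump_plus N d h * (u <= h < v)%R%:R.

Lemma jump_in_ge0 u v h : c <= h -> h <= d -> 0 <= jump_in u v h.
Proof.
by move=> ch hd; rewrite addr_ge0// mulr_ge0 ?jump_minus_ge0 ?jump_plus_ge0.
Qed.

Lemma jump_in_le u v h : c <= u -> u <= h -> h <= v -> v <= d ->
  jump_in u v h <= N v - N u.
Proof.
move=> cu uh hv vd; rewrite /jump_in uh hv andbT /=.
have -> : N v - N u = (N h - N u) + (N v - N h) by ring.
have ch := le_trans cu uh; have hd := le_trans hv vd.
apply: lerD.
  have [uh'|hu] := ltP u h; rewrite ?mulr1 ?mulr0 ?subr_ge0 ?ndN'//.
  by rewrite lerD2l lerN2 le_left_lim.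
have [hv'|vh] := ltP h v; rewrite ?mulr1 ?mulr0 ?subr_ge0 ?ndN'//.
by rewrite lerD2r right_lim_le.
Qed.

(** Induction on the sorted list: cut [[u, v]] at the midpoint [m] of the first two points. The
    first jump is then seen by [[u, m]], all the others by [[m, v]], and the increments of [N] add
    up. *)
Lemma sum_jump_in_le s u v : c <= u -> u <= v -> v <= d ->
  sorted <%R s -> {in s, forall h, u <= h <= v} ->
  \sum_(h <- s) jump_in u v h <= N v - N u.
Proof.
elim: s u => [|h s IH] u cu uv vd; first by rewrite big_nil subr_ge0 ndN'.
move=> /= hs suv; rewrite big_cons.
have /andP[uh hv] := suv h (mem_head _ _).
case: s IH hs suv => [|h' s] IH hs suv.
  by rewrite big_nil addr0 jump_in_le.
have hh' : h < h' by case/andP: hs.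
have /andP[_ h'v] : u <= h' <= v by apply: suv; rewrite !inE eqxx orbT.
pose m := (h + h') / 2.
have hm : h < m by rewrite /m; lra.
have mh' : m < h' by rewrite /m; lra.
have mv := le_trans (ltW mh') h'v.
have cm := le_trans cu (le_trans uh (ltW hm)).
have /= sh' := hs; case/andP: sh' => _ sh'.
have ms k : k \in h' :: s -> m < k.
  rewrite inE => /predU1P[->//|ks]; apply: lt_trans mh' _.
  by have /allP/(_ _ ks) := order_path_min lt_trans sh'.
have -> : jump_in u v h = jump_in u m h.
  by rewrite /jump_in hv (lt_le_trans hm mv) (ltW hm) hm.
have -> : \sum_(k <- h' :: s) jump_in u v k = \sum_(k <- h' :: s) jump_in m v k.
  apply: eq_big_seq => k /ms mk.
  have uk : u < k by apply: le_lt_trans uh (lt_trans hm mk).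
  by rewrite /jump_in mk uk (ltW mk) (ltW uk).
have -> : N v - N u = (N m - N u) + (N v - N m) by ring.
apply: lerD.
  by apply: jump_in_le => //; [exact: ltW|exact: le_trans mv vd].
apply: IH => // k ks; rewrite (ltW (ms _ ks))/=.
by have /andP[] : u <= k <= v by apply: suv; rewrite inE ks orbT.
Qed.

Lemma esum_jump_in_le H u v : c <= u -> u <= v -> v <= d ->
  (\esum_(h in H) (jump_in u v h)%:E <= (N v - N u)%:E)%E.
Proof.
move=> cu uv vd; apply: ge_ereal_sup => _ [A [finA _] <-].
rewrite fsbig_finite//= sumEFin lee_fin.
(* Points outside [[u, v]] contribute 0; the remaining finitely many are sorted to fit
   [sum_jump_in_le]. *)
rewrite (bigID (fun h => u <= h <= v))/= [X in _ + X]big1 ?addr0; last first.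
  move=> h; rewrite negb_and -!ltNge => /orP[hu|vh]; rewrite /jump_in.
    by rewrite (ltNge u) (ltW hu)/= (leNgt u) hu/= !mulr0 addr0.
  by rewrite (leNgt h) vh andbF (ltNge h) (ltW vh) andbF !mulr0 addr0.
rewrite -big_filter -(perm_big _ (permEl (perm_sort <=%R _)))/=.
apply: sum_jump_in_le => //.
  rewrite lt_sorted_uniq_le sort_uniq filter_uniq ?finmap.fset_uniq//=.
  exact: sort_le_sorted.
by move=> h; rewrite mem_sort mem_filter => /andP[].
Qed.

Section JumpSum.
Variable H : set R.
Hypothesis Hcd : H `<=` `[c, d]%classic.

Let Hc h : H h -> c <= h. Proof. by move=> /Hcd/=; rewrite in_itv/= => /andP[]. Qed.
Let Hd h : H h -> h <= d. Proof. by move=> /Hcd/=; rewrite in_itv/= => /andP[]. Qed.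

(** For [c <= u <= v <= d] the sum is at most [N v - N u], so [fine] loses nothing; see
    [esum_jump_in]. *)
Definition jump_sum u v : R := fine (\esum_(h in H) (jump_in u v h)%:E)%E.

Lemma esum_jump_in u v : c <= u -> u <= v -> v <= d ->
  (\esum_(h in H) (jump_in u v h)%:E = (jump_sum u v)%:E)%E.
Proof.
move=> cu uv vd; rewrite /jump_sum fineK// ge0_fin_numE.
  exact: le_lt_trans (esum_jump_in_le _ cu uv vd) (ltry _).
by apply: esum_ge0 => h Hh; rewrite lee_fin jump_in_ge0 ?Hc ?Hd.
Qed.

Lemma jump_sum_le u v : c <= u -> u <= v -> v <= d -> jump_sum u v <= N v - N u.
Proof. by move=> cu uv vd; rewrite -lee_fin -esum_jump_in// esum_jump_in_le. Qed.

Lemma jump_sum_ge u v h : c <= u -> u <= v -> v <= d -> H h ->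
  jump_in u v h <= jump_sum u v.
Proof.
move=> cu uv vd Hh; rewrite -lee_fin -esum_jump_in//.
apply: esum_ge; exists [set h]; last by rewrite fsbig_set1.
by split; [exact: finite_set1|move=> _ ->].
Qed.

(** The half-open conventions in [jump_in] split a jump at [u] without overlap: its left part is
    counted up to [u], its right part from [u] on. *)
Lemma jump_sumD u v : c <= u -> u <= v -> v <= d ->
  jump_sum c v = jump_sum c u + jump_sum u v.
Proof.
move=> cu uv vd; apply: EFin_inj; rewrite EFinD.
have cv := le_trans cu uv; have ud := le_trans uv vd.
rewrite -!esum_jump_in// -esumD; last 2 first.
- by move=> h Hh; rewrite lee_fin jump_in_ge0 ?Hc ?Hd.
- by move=> h Hh; rewrite lee_fin jump_in_ge0 ?Hc ?Hd.
apply: eq_esum => h Hh; rewrite -EFinD; congr _%:E; rewrite /jump_in (Hc Hh)/=.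
have E1 : (c < h <= v)%R%:R = (c < h <= u)%R%:R + (u < h <= v)%R%:R :> R.
  have [hu|uh] := leP h u; first by rewrite (le_trans hu uv) andbT addr0.
  by rewrite (le_lt_trans cu uh) add0r.
have E2 : (h < v)%R%:R = (h < u)%R%:R + (u <= h < v)%R%:R :> R.
  have [hu|uh] := ltP h u; first by rewrite (lt_le_trans hu uv) addr0.
  by rewrite add0r.
by rewrite E1 E2; ring.
Qed.

End JumpSum.
End Jumps.

(** * The generalized inverses of [M] and its level set [H] *)

Section GeneralizedInverses.
Variables (R : realType) (a b : R) (M : R -> R).
Hypothesis hab : a < b.
Hypothesis hM : {in `[a, b]%classic &, {homo M : x y / x <= y}}.
Implicit Types (x y : R).

Lemma nondecreasing_in x y : a <= x -> x <= y -> y <= b -> M x <= M y.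
Proof.
move=> ax xy yb; apply: hM => //; rewrite inE/= in_itv/= ?ax ?yb ?andbT//.
  exact: le_trans yb.
exact: le_trans xy.
Qed.

Lemma nondecreasing_ends : M a <= M b.
Proof. exact: nondecreasing_in (ltW hab) _. Qed.

Lemma Hset_sub : Hset a b M `<=` `[M a, M b]%classic.
Proof. by move=> y []. Qed.

(** Between two preimages of [y] lies a rational, where monotonicity forces [M] to equal [y]; so [H]
    lies in the image of the rationals. *)
Lemma countable_Hset : countable (Hset a b M).
Proof.
apply: (@sub_countable _ _ _ [set M (ratr q) | q in [set: rat]]).
  apply: subset_card_le => y [_ [x1 [x2 [neq]]]].
  wlog : x1 x2 neq / x1 < x2.
    move=> W; have [x12|x21|e] := ltgtP x1 x2; first exact: W.
      by move=> h1 h2 e1 e2; apply: (W x2 x1) => //; rewrite eq_sym.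
    by rewrite e eqxx in neq.
  move=> x12; rewrite /= !in_itv/= => /andP[ax1 _] /andP[_ x2b] e1 e2.
  have [q] := rat_in_itvoo x12; rewrite in_itv/= => /andP[x1q qx2].
  exists q => //; apply/eqP; rewrite eq_le; apply/andP; split.
    by rewrite -e2 nondecreasing_in// ltW// (le_lt_trans ax1).
  by rewrite -e1 nondecreasing_in// ltW// (lt_le_trans qx2).
by apply: (sub_countable (card_image_le _ _)); exact: countableP.
Qed.

Lemma Xf_le x y : a <= x -> x <= b -> y <= M x -> Xf a b M y <= x.
Proof.
move=> ax xb yx; apply: ge_inf.
  by exists a => z [/=]; rewrite in_itv/= => /andP[].
by split=> //=; rewrite in_itv/= ax.
Qed.

Lemma Xf_ge_left y : y <= M b -> a <= Xf a b M y.
Proof.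
move=> yb; apply: lb_le_inf; last by move=> z [/=]; rewrite in_itv/= => /andP[].
by exists b; split => //=; rewrite in_itv/= lexx ltW.
Qed.

(** A partial converse of [Xf_le]. The inequality must be strict: without right-continuity of [M]
    the infimum need not be attained. *)
Lemma Xf_lt x y : y <= M b -> x <= b -> Xf a b M y < x -> y <= M x.
Proof.
move=> yb xb Xx.
have hinf : [set x | `[a, b]%classic x /\ y <= M x] !=set0.
  by exists b; split => //=; rewrite in_itv/= lexx ltW.
have [z [/= + yz] zx] := inf_lt hinf Xx; rewrite in_itv/= => /andP[az zb].
by apply: le_trans yz _; apply: nondecreasing_in => //; exact: ltW.
Qed.

Lemma Xif_ge x y : a <= x -> x <= b -> M x <= y -> x <= Xif a b M y.
Proof.
move=> ax xb xy; apply: ub_le_sup.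
  by exists b => z [/=]; rewrite in_itv/= => /andP[].
by split=> //=; rewrite in_itv/= ax.
Qed.

Lemma Xif_le_right y : M a <= y -> Xif a b M y <= b.
Proof.
move=> ay; apply: ge_sup; last by move=> z [/=]; rewrite in_itv/= => /andP[].
by exists a; split => //=; rewrite in_itv/= lexx ltW.
Qed.

Lemma Xif_le x y : M a <= y -> a <= x -> y < M x -> Xif a b M y <= x.
Proof.
move=> ay ax yx; apply: ge_sup.
  by exists a; split => //=; rewrite in_itv/= lexx ltW.
move=> z [/=]; rewrite in_itv/= => /andP[az zb] zy.
rewrite leNgt; apply/negP => xz.
have := lt_le_trans yx (nondecreasing_in ax (ltW xz) zb).
by rewrite ltNge zy.
Qed.

Lemma Xf_itv y : M a <= y <= M b -> a <= Xf a b M y <= b.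
Proof. by move=> /andP[ay yb]; rewrite Xf_ge_left//= Xf_le// ltW. Qed.

Lemma Xif_itv y : M a <= y <= M b -> a <= Xif a b M y <= b.
Proof. by move=> /andP[ay yb]; rewrite Xif_le_right// Xif_ge// ltW. Qed.

Lemma Xf_nondecreasing y1 y2 : y1 <= y2 -> M a <= y2 <= M b ->
  Xf a b M y1 <= Xf a b M y2.
Proof.
move=> y12 /andP[ay2 y2b]; apply: lb_le_inf.
  by exists b; split => //=; rewrite in_itv/= lexx ltW.
move=> z [/=]; rewrite in_itv/= => /andP[az zb] y2z.
by apply: Xf_le => //; exact: le_trans y2z.
Qed.

Lemma Xif_nondecreasing y1 y2 : y1 <= y2 -> M a <= y1 <= M b ->
  Xif a b M y1 <= Xif a b M y2.
Proof.
move=> y12 /andP[ay1 y1b]; apply: ge_sup.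
  by exists a; split => //=; rewrite in_itv/= lexx ltW.
move=> z [/=]; rewrite in_itv/= => /andP[az zb] zy1.
by apply: Xif_ge => //; exact: le_trans y12.
Qed.

(** If [X < Xi], then [M] equals [y] strictly between them, which yields two preimages. If [Xi < X],
    the midpoint would satisfy neither [M x <= y] nor [y <= M x]. *)
Lemma Hset_of_Xf_neq_Xif y : M a <= y <= M b -> Xf a b M y != Xif a b M y ->
  Hset a b M y.
Proof.
move=> yab; have /andP[ay yb] := yab.
have /andP[aX Xb] := Xf_itv yab; have /andP[aXi Xib] := Xif_itv yab.
move: aX Xb aXi Xib; set X := Xf a b M y; set Xi := Xif a b M y => aX Xb aXi Xib.
have mid x : X < x -> x < Xi -> M x = y.
  move=> Xx xXi; apply/eqP; rewrite eq_le; apply/andP; split.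
    rewrite leNgt; apply/negP => yx.
    by have := Xif_le ay (le_trans aX (ltW Xx)) yx; rewrite leNgt xXi.
  by apply: Xf_lt => //; exact: le_trans (ltW xXi) Xib.
rewrite neq_lt => /orP[XXi|XiX].
  split; first by rewrite /= in_itv/= ay yb.
  pose x1 := (X + Xi) / 2; pose x2 := (x1 + Xi) / 2.
  have [? ? ?] : [/\ X < x1, x1 < x2 & x2 < Xi] by rewrite /x2 /x1; split; lra.
  have [? ?] : X < x2 /\ x1 < Xi by split; lra.
  exists x1, x2; split; rewrite ?mid//= ?lt_eqF//= in_itv/=.
    by apply/andP; split; lra.
  by apply/andP; split; lra.
pose x := (X + Xi) / 2.
have [Xix xX] : Xi < x /\ x < X by rewrite /x; split; lra.
have ax := le_trans aXi (ltW Xix); have xb := le_trans (ltW xX) Xb.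
have : ~~ (M x <= y) by apply/negP => /(Xif_ge ax xb); rewrite leNgt Xix.
by rewrite -ltNge => /ltW/(Xf_le ax xb); rewrite leNgt xX.
Qed.

End GeneralizedInverses.

(** * The function [N1] and its measure near points of [H] *)

Section ContinuousPart.
Variables (R : realType) (a b : R) (M N : R -> R).
Hypothesis hab : a < b.
Hypothesis hM : {in `[a, b]%classic &, {homo M : x y / x <= y}}.
Hypothesis hN : {in `[M a, M b]%classic &, {homo N : x y / x <= y}}.
Implicit Types (u v x y : R).

Local Notation H := (Hset a b M).
Local Notation c := (M a).
Local Notation d := (M b).
Local Notation N1 := (N1 a b M N).
Local Notation jump_sum := (jump_sum c d N H).

Let Hcd : H `<=` `[c, d]%classic := @Hset_sub R a b M.
Let cd : c <= d := nondecreasing_ends hab hM.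

Let Hc y : H y -> c <= y.
Proof. by move=> /Hcd/=; rewrite in_itv/= => /andP[]. Qed.

Let Hd y : H y -> y <= d.
Proof. by move=> /Hcd/=; rewrite in_itv/= => /andP[]. Qed.

(** The summands are nonnegative on [H], so the negative part in [sum_over] vanishes and what
    remains agrees termwise with [jump_in c y]. *)
Lemma N1E y : c <= y -> y <= d -> N1 y = N y - jump_sum c y.
Proof.
move=> cy yd; congr (_ - fine _).
set g := (X in sum_over _ X); rewrite /sum_over.
have gE h : H h -> g h = jump_in c d N c y h.
  move=> Hh; rewrite /g /jump_in /Defs.indic; congr (_ + _).
    (* At [h = c] the two indicators differ, but the left jump is 0 by convention. *)
    have [<-|ch] := eqVneq c h; first by rewrite /jump_minus /left_lim eqxx subrr !mul0r.
    rewrite lt_neqAle ch (Hc Hh)/=; congr (_ * _); have [hy|yh] := leP h y.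
      by rewrite asboolT//= in_itv/= hy yd.
    by rewrite asboolF//= in_itv/= leNgt yh.
  rewrite (Hc Hh)/=; congr (_ * _); have [hy|yh] := ltP h y.
    by rewrite asboolT//= in_itv/= hy yd.
  by rewrite asboolF//= in_itv/= ltNge yh.
have g0 h : H h -> 0 <= g h by move=> Hh; rewrite gE// jump_in_ge0 ?Hc ?Hd.
rewrite [X in (_ - X)%E]esum1 ?sube0.
  apply: eq_esum => h Hh; rewrite -gE// /funrpos max_l// g0//.
by move=> h Hh; rewrite /funrneg max_r// oppr_le0 g0.
Qed.

Lemma N1B u v : c <= u -> u <= v -> v <= d ->
  N1 v - N1 u = N v - N u - jump_sum u v.
Proof.
move=> cu uv vd; rewrite !N1E// ?(le_trans cu)// ?(le_trans uv)//.
by rewrite (jump_sumD hN Hcd cu uv vd); ring.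
Qed.

Lemma N1_nondecreasing : {in `[c, d]%classic &, {homo N1 : x y / x <= y}}.
Proof.
move=> u v; rewrite !inE/= !in_itv/= => /andP[cu _] /andP[_ vd] uv.
by rewrite -subr_ge0 N1B// subr_ge0 jump_sum_le.
Qed.

(** The right jump at [y] is one term of [jump_sum y v], hence is removed from the increment of [N].
    As [v] decreases to [y] the bound tends to 0, so this is right-continuity in quantitative
    form. *)
Lemma N1_right_continuous y v : H y -> y < v -> v <= d ->
  N1 v - N1 y <= N v - right_lim N d y.
Proof.
move=> Hy yv vd; rewrite N1B ?Hc ?(ltW yv)//.
have := jump_sum_ge hN Hcd (Hc Hy) (ltW yv) vd Hy.
by rewrite /jump_in ltxx lexx yv/= mulr0 mulr1 add0r /jump_plus; lra.
Qed.

Lemma N1_left_continuous y u : H y -> c <= u -> u < y ->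
  N1 y - N1 u <= left_lim N c y - N u.
Proof.
move=> Hy cu uy; rewrite N1B ?Hd ?(ltW uy)//.
have := jump_sum_ge hN Hcd cu (ltW uy) (Hd Hy) Hy.
by rewrite /jump_in uy lexx ltxx andbF/= mulr0 mulr1 addr0 /jump_minus; lra.
Qed.

Variable mu1 : {measure set R -> \bar R}.
Hypothesis hmu1 : LS_squeeze N1 c d mu1.

(** The squeeze gives the bound at every [v > y]; right-continuity of [N1] at [y] closes the gap. At
    [y = d] the total mass serves instead. *)
Lemma mu1_Hset_le y : H y -> (mu1 `[c, y]%classic <= (N1 y - N1 c)%:E)%E.
Proof.
have [tot up _] := hmu1.
move=> Hy; have := Hd Hy; rewrite le_eqVlt => /predU1P[->|yd]; first by rewrite tot.
apply/lee_addgt0Pr => e e0.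
have [v [yv vd vle]] := right_lim_adherent hN (Hc Hy) yd e0.
apply: le_trans (up _ _ (Hc Hy) yv vd) _.
rewrite -EFinD lee_fin; have := N1_right_continuous Hy yv vd; lra.
Qed.

Lemma mu1_Hset_ge y : H y -> ((N1 y - N1 c)%:E <= mu1 `[c, y[%classic)%E.
Proof.
have [_ _ low] := hmu1.
move=> Hy; have := Hc Hy; rewrite le_eqVlt => /predU1P[<-|cy]; first by rewrite subrr.
apply/lee_addgt0Pr => e e0.
have [u [cu uy ule]] := left_lim_adherent hN cy (Hd Hy) e0.
apply: (@le_trans _ _ ((N1 u - N1 c)%:E + e%:E)%E); last first.
  by rewrite leeD2r// low// Hd.
rewrite -EFinD lee_fin; have := N1_left_continuous Hy cu uy; lra.
Qed.

(** The masses of [[c, y]] and [[c, y[] are bounded by the same number [N1 y - N1 c], from above and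
    from below, which leaves nothing for the point. *)
Lemma mu1_Hset1 y : H y -> mu1 [set y] = 0%E.
Proof.
move=> Hy; have cy := Hc Hy.
have E : mu1 `[c, y]%classic = (mu1 `[c, y[%classic + mu1 [set y])%E.
  rewrite -measureU//; first by rewrite setUitv1// bnd_simp.
  - by rewrite -subset0 => z [/= + zy]; rewrite zy in_itv/= ltxx andbF.
have le1 := mu1_Hset_le Hy; have le2 := mu1_Hset_ge Hy.
have fin : mu1 `[c, y[%classic \is a fin_num.
  rewrite ge0_fin_numE//; apply: (@le_lt_trans _ _ (mu1 `[c, y]%classic)).
    by rewrite E leeDl.
  exact: le_lt_trans le1 (ltry _).
apply/eqP; rewrite eq_le measure_ge0 andbT.
rewrite -(@leeD2lE _ (mu1 `[c, y[%classic))// -E adde0.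
exact: le_trans le1 le2.
Qed.

(** Meant for [A] the preimage of [[a, x]] under [X]. With [x''] between [x] and [x'], [A] lies in
    [[c, M x'']]; if [M x'' = M x'], this value has two preimages, so it is in [H] and [mu1_Hset_le]
    replaces the squeeze. *)
Lemma mu1_Xf_le A x x' : a <= x -> x < x' -> x' <= b -> measurable A ->
  (forall y, A y -> c <= y <= d /\ Xf a b M y <= x) ->
  (mu1 A <= (N1 (M x') - N1 c)%:E)%E.
Proof.
move=> ax xx' x'b mA HA; have [_ up _] := hmu1.
pose x'' := (x + x') / 2.
have [xx'' x''x'] : x < x'' /\ x'' < x' by rewrite /x''; split; lra.
have ax'' := le_trans ax (ltW xx''); have x''b := le_trans (ltW x''x') x'b.
have cx'' : c <= M x'' by exact: (nondecreasing_in hM).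
have Asub : A `<=` `[c, M x'']%classic.
  move=> y /HA[/andP[cy yd] Xy]; rewrite /= in_itv/= cy/=.
  by apply: (Xf_lt hab hM) => //; exact: le_lt_trans xx''.
have leA : (mu1 A <= mu1 `[c, M x'']%classic)%E.
  by apply: le_measure => //; rewrite inE//; exact: measurable_itv.
apply: le_trans leA _.
have x'd : M x' <= d by apply: (nondecreasing_in hM) => //; exact: le_trans (ltW x''x').
have := nondecreasing_in hM ax'' (ltW x''x') x'b.
rewrite le_eqVlt => /predU1P[e|lt]; last exact: up.
rewrite -e; apply: mu1_Hset_le; split; first by rewrite /= in_itv/= cx'' e x'd.
exists x'', x'; split => //; first by rewrite lt_eqF.
  by rewrite /= in_itv/= ax''.
by rewrite /= in_itv/= x'b (le_trans ax'' (ltW x''x')).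
Qed.

Lemma mu1_Xf_ge A x x' : a <= x -> x < x' -> x' <= b -> measurable A ->
  (forall y, c <= y <= d -> Xf a b M y < x' -> A y) ->
  ((N1 (M x) - N1 c)%:E <= mu1 A)%E.
Proof.
move=> ax xx' x'b mA HA; have [_ _ low] := hmu1.
pose x'' := (x + x') / 2.
have [xx'' x''x'] : x < x'' /\ x'' < x' by rewrite /x''; split; lra.
have ax'' := le_trans ax (ltW xx''); have x''b := le_trans (ltW x''x') x'b.
have cx : c <= M x by apply: (nondecreasing_in hM) => //; exact: le_trans (ltW xx'') x''b.
have x''d : M x'' <= d by exact: (nondecreasing_in hM).
have leA : (mu1 `[c, M x'']%classic <= mu1 A)%E.
  apply: le_measure => //; rewrite ?inE//.
  move=> y /=; rewrite in_itv/= => /andP[cy yx'']; apply: HA.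
    by rewrite cy (le_trans yx'').
  by apply: le_lt_trans x''x'; exact: Xf_le.
apply: le_trans leA.
have ltc v : (mu1 `[c, v[%classic <= mu1 `[c, v]%classic)%E.
  by apply: le_measure; rewrite ?inE//; apply: subset_itvl; rewrite bnd_simp.
have := nondecreasing_in hM ax (ltW xx'') x''b.
rewrite le_eqVlt => /predU1P[e|lt]; last exact: le_trans (low _ _ cx lt x''d) (ltc _).
rewrite e; apply: le_trans (ltc _); apply: mu1_Hset_ge.
split; first by rewrite /= in_itv/= -e cx e.
exists x, x''; split => //; first by rewrite lt_eqF.
  by rewrite /= in_itv/= ax (le_trans (ltW xx'')).
by rewrite /= in_itv/= x''b ax''.
Qed.

End ContinuousPart.

(** * Atomic and image measures, null sets, measurability of monotone maps *)

Section AuxiliaryMeasures.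
Variable R : realType.
Implicit Types (H : set R) (w phi : R -> R) (mu : {measure set R -> \bar R}).

(** The measure is the sum of the Dirac masses [w h] at [phi h], arranged as a series over the
    integers through an injection of [H]. The integral formula characterises it and also yields its
    values on sets. *)
Lemma atomic_measure_exists H w phi : countable H -> (forall h, H h -> 0 <= w h) ->
  exists m : {measure set R -> \bar R}, forall (D : set R) (f : R -> \bar R),
    measurable D -> measurable_fun D f -> (forall x, D x -> (0 <= f x)%E) ->
    (forall h, H h -> D (phi h)) ->
    (\int[m]_(x in D) f x = \esum_(h in H) ((w h)%:E * f (phi h)))%E.
Proof.
move=> /countable_injP[e einj] w0.
(* A left inverse of [e] on [H]; the default 0 occurs only at integers outside the image of [H],
   where the weight [wn] is 0. *)
pose i n := xget 0 [set h | H h /\ e h = n].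
have iK h : H h -> i (e h) = h.
  move=> Hh; have [Hi ei] : H (i (e h)) /\ e (i (e h)) = e h.
    by apply: (@xgetPex _ 0 [set k | H k /\ e k = e h]); exists h.
  by apply: einj => //; rewrite inE.
pose wn n := if n \in e @` H then w (i n) else 0.
have wn0 n : 0 <= wn n.
  by rewrite /wn; case: ifPn => //; rewrite inE => -[h Hh <-]; rewrite iK// w0.
pose m_ n : {measure set R -> \bar R} := mscale (NngNum (wn0 n)) (\d_(phi (i n))).
exists (mseries m_ 0) => D f mD mf f0 HD.
rewrite ge0_integral_measure_series// nneseries_esumT; last first.
  by move=> n; apply: integral_ge0.
rewrite [RHS](_ : _ = \esum_(n in e @` H) ((w (i n))%:E * f (phi (i n))))%E.
  rewrite [RHS]esum_mkcond; apply: eq_esum => n _.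
  rewrite ge0_integral_mscale// integral_dirac//= /wn.
  case: ifPn => [|_]; last by rewrite mul0e.
  by rewrite inE => -[h Hh <-]; rewrite iK// diracE mem_set ?mul1e//; exact: HD.
rewrite (@reindex_esum _ _ _ H _ e); last first.
  by split; [move=> h Hh; exists h|exact: einj|].
by apply: eq_esum => h Hh; rewrite iK.
Qed.

Lemma pushforward_measure_exists mu phi : measurable_fun setT phi ->
  exists nu : {measure set R -> \bar R}, nu = pushforward mu phi :> (set R -> \bar R).
Proof. by move=> mphi; unshelve eexists (pushforward mu phi : {measure set R -> \bar R}). Qed.

(** An injection into the integers writes [H] as a countable union of sets with at most one
    point. *)
Lemma countable_negligible mu H : countable H ->
  (forall h, H h -> mu [set h] = 0%E) -> mu.-negligible H.
Proof.
move=> /countable_injP[e einj] mu0.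
apply: (@negligibleS _ _ _ _ (\bigcup_n [set h | H h /\ e h = n])).
  by move=> h Hh; exists (e h).
apply: negligible_bigcup => n.
have [->|/set0P[h [Hh ehn]]] := eqVneq [set h | H h /\ e h = n] set0.
  exact: negligible_set0.
exists [set h]; split => //; first exact: mu0.
by move=> k [Hk ekn]; apply: einj; rewrite ?inE// ekn.
Qed.

(** The preimage of a half-line [[r, +oo[] in [[c, d]] is order-convex, hence an interval. *)
Lemma nondecreasing_itv_measurable (c d : R) (g : R -> R) :
  {in `[c, d]%classic &, {homo g : x y / x <= y}} ->
  measurable_fun `[c, d]%classic g.
Proof.
move=> ndg; apply: (measurability (@RGenCInfty.G R)) => [|/= _ [_] [r] -> <-].
  exact: RGenCInfty.measurableE.
apply: is_interval_measurable => s t /= [] + + [].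
rewrite !in_itv/= !andbT => /andP[cs sd] rs /andP[ct td] rt u /andP[su ut].
have [cu ud] := (le_trans cs su, le_trans ut td).
rewrite !in_itv/= cu ud; split=> //; rewrite andbT; apply: le_trans rs _.
by apply: ndg; rewrite ?inE//= in_itv/= ?cs ?cu.
Qed.

End AuxiliaryMeasures.

(** * The image measure and the formula for nonnegative functions *)

Section Substitution.
Variables (R : realType) (a b : R) (M N : R -> R).
Hypothesis hab : a < b.
Hypothesis hM : {in `[a, b]%classic &, {homo M : x y / x <= y}}.
Hypothesis hN : {in `[M a, M b]%classic &, {homo N : x y / x <= y}}.
Variables muL mu1 : {measure set R -> \bar R}.
Hypothesis hmuL : LS_squeeze (N \o M) a b muL.
Hypothesis hmu1 : LS_squeeze (N1 a b M N) (M a) (M b) mu1.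
Implicit Types (x y h : R) (f : R -> R).

Local Notation H := (Hset a b M).
Local Notation c := (M a).
Local Notation d := (M b).
Local Notation X := (Xf a b M).
Local Notation Xi := (Xif a b M).
Local Notation Dm := (jump_minus N c).
Local Notation Dp := (jump_plus N d).

Let Hitv h : H h -> c <= h <= d.
Proof. by move=> [/=]; rewrite in_itv. Qed.

Let Dm0 h : H h -> 0 <= Dm h.
Proof. by move=> /Hitv/andP[? ?]; exact: jump_minus_ge0 hN _ _ _. Qed.

Let Dp0 h : H h -> 0 <= Dp h.
Proof. by move=> /Hitv/andP[? ?]; exact: jump_plus_ge0 hN _ _ _. Qed.

Let Dm_left : Dm c = 0.
Proof. by rewrite /jump_minus /left_lim eqxx subrr. Qed.

Let Dp_right : Dp d = 0.
Proof. by rewrite /jump_plus /right_lim eqxx subrr. Qed.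

(* Values outside [[a, b]] off [[c, d]], so that no restriction of [mu1] is needed. *)
Let X' y := if y < c then a - 1 else if d < y then b + 1 else X y.

Let X'E y : c <= y <= d -> X' y = X y.
Proof. by rewrite /X' !leNgt => /andP[/negbTE-> /negbTE->]. Qed.

Let X'_itv y : a <= X' y <= b -> c <= y <= d.
Proof.
rewrite /X'; case: (ltP y c) => yc; first by rewrite lerBrDr gerDl ler10.
by case: (ltP d y) => dy //; rewrite gerDl ler10 andbF.
Qed.

Let X'_nondecreasing : {homo X' : x y / x <= y}.
Proof.
move=> y1 y2 y12; rewrite /X'.
have Xitv y : c <= y -> y <= d -> a <= X y <= b.
  by move=> cy yd; apply: (Xf_itv hab); rewrite cy yd.
case: (ltP y1 c) => y1c.
  case: (ltP y2 c) => y2c //; case: (ltP d y2) => dy2; first by have := hab; lra.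
  by have /andP[] := Xitv _ y2c dy2; lra.
have y2c := le_trans y1c y12; rewrite (ltNge y2) y2c/=.
case: (ltP d y1) => dy1; first by rewrite (lt_le_trans dy1 y12).
case: (ltP d y2) => dy2; first by have /andP[] := Xitv _ y1c dy1; lra.
by apply: (Xf_nondecreasing hab) => //; rewrite y2c.
Qed.

Let mX' : measurable_fun setT X'.
Proof. by apply: nondecreasing_measurable => //; exact: X'_nondecreasing. Qed.

Section ImageMeasure.
Variables nu mm mp : {measure set R -> \bar R}.
Hypothesis nuE : nu = pushforward mu1 X' :> (set R -> \bar R).
Hypothesis mmE : forall A, measurable A ->
  (mm A = \esum_(h in H) (Dm h * \1_A (X h))%:E)%E.
Hypothesis mpE : forall A, measurable A ->
  (mp A = \esum_(h in H) (Dp h * \1_A (Xi h))%:E)%E.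

Let rho : {measure set R -> \bar R} := measure_add (measure_add nu mm) mp.

(** Merges both families of atoms into a single sum over [H], ready for termwise comparison with
    [jump_in]. *)
Let rhoE A : measurable A -> (rho A = mu1 (X' @^-1` A) +
  \esum_(h in H) (Dm h * \1_A (X h) + Dp h * \1_A (Xi h))%:E)%E.
Proof.
move=> mA.
have -> : rho A = (nu A + mm A + mp A)%E.
  apply: etrans (measure_addE (measure_add nu mm) mp A) _.
  by congr (_ + _)%E; exact: measure_addE.
rewrite nuE mmE// mpE// -addeA -esumD.
- by [].
- by move=> h Hh; rewrite lee_fin mulr_ge0// Dm0.
- by move=> h Hh; rewrite lee_fin mulr_ge0// Dp0.
Qed.

Let mX'A A : measurable A -> measurable (X' @^-1` A).
Proof. by move=> mA; rewrite -[X in measurable X]setTI; exact: mX'. Qed.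

(** Splits the increment of [N] into a part to compare with [mu1] and a part to compare with the
    atoms. *)
Let sum_split v : c <= v -> v <= d ->
  (N v - N c = N1 a b M N v - N1 a b M N c + jump_sum c d N H c v).
Proof. by move=> cv vd; rewrite (N1B hN)//; ring. Qed.

Lemma image_measure_squeeze : LS_squeeze (N \o M) a b rho.
Proof.
have cd := nondecreasing_ends hab hM.
split => [|u v au uv vb|u v au uv vb] /=.
- rewrite rhoE; last exact: measurable_itv.
  rewrite sum_split// EFinD -(esum_jump_in hN (@Hset_sub R a b M))//; congr (_ + _)%E.
    have [<- _ _] := hmu1; congr (mu1 _); apply/seteqP; split => y /=; rewrite !in_itv/=.
      exact: X'_itv.
    by move=> ycd; rewrite X'E// (Xf_itv hab).
  apply: eq_esum => h Hh; congr _%:E; have hcd := Hitv Hh.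
  rewrite !indicE !mem_set/=; [|by rewrite in_itv/= Xif_itv|by rewrite in_itv/= Xf_itv].
  have /andP[ch hd] := hcd.
  (* [jump_in c d] omits the left jump at [c] and the right jump at [d], whose atoms have weight 0
     by convention. *)
  rewrite /jump_in ch hd/= andbT; congr (_ + _).
    by have [ch'|hc] := ltP c h => //; rewrite (@le_anti _ _ h c) ?hc// Dm_left !mul0r.
  by have [hd'|dh] := ltP h d => //; rewrite (@le_anti _ _ h d) ?hd// Dp_right !mul0r.
- have av := le_trans au (ltW uv).
  have cv : c <= M v by exact: (nondecreasing_in hM).
  have vd : M v <= d by exact: (nondecreasing_in hM).
  rewrite rhoE; last exact: measurable_itv.
  rewrite sum_split// EFinD; apply: leeD.
    apply: (mu1_Xf_le hab hM hN hmu1 au uv vb).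
      by apply: mX'A; exact: measurable_itv.
    move=> y /=; rewrite in_itv/= => /andP[aX Xu].
    have ycd : c <= y <= d by apply: X'_itv; rewrite aX (le_trans Xu)// (le_trans (ltW uv)).
    by rewrite -X'E.
  rewrite -(esum_jump_in hN (@Hset_sub R a b M))//.
  apply: le_esum => h Hh; rewrite lee_fin; have /andP[ch hd] := Hitv Hh.
  rewrite /jump_in; apply: lerD; rewrite indicE.
    have [<-|hc] := eqVneq c h; first by rewrite Dm_left !mul0r.
    rewrite ler_wpM2l ?Dm0// ler_nat lt_neqAle hc ch/=.
    case: (boolP (_ \in _)) => //; rewrite inE/= in_itv/= => /andP[_ Xu].
    by rewrite lt0b (Xf_lt hab hM)// (le_lt_trans Xu).
  rewrite ler_wpM2l ?Dp0// ler_nat ch/=.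
  case: (boolP (_ \in _)) => //; rewrite inE/= in_itv/= => /andP[_ Xu].
  (* If [M v <= h], then [v <= Xi h], against [Xi h <= u < v]. This gives the strict [h < M v] that
     [jump_in] asks of right jumps. *)
  rewrite lt0b ltNge; apply/negP => /(Xif_ge av vb).
  by rewrite leNgt (le_lt_trans Xu).
- have ub := le_trans (ltW uv) vb.
  have cu : c <= M u by exact: (nondecreasing_in hM).
  have ud : M u <= d by exact: (nondecreasing_in hM).
  rewrite rhoE; last exact: measurable_itv.
  rewrite sum_split// EFinD; apply: leeD.
    apply: (mu1_Xf_ge hM hN hmu1 au uv vb).
      by apply: mX'A; exact: measurable_itv.
    move=> y ycd Xv; rewrite /= in_itv/= X'E// Xv andbT.
    by have /andP[] := Xf_itv hab ycd.
  rewrite -(esum_jump_in hN (@Hset_sub R a b M))//.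
  apply: le_esum => h Hh; rewrite lee_fin; have hcd := Hitv Hh.
  have /andP[ch hd] := hcd.
  rewrite /jump_in; apply: lerD; rewrite indicE.
    (* The implications now run backwards: [h <= M u] puts [X h], and [h < M u] puts [Xi h], at or
       below [u], hence in [[a, v[]. *)
    rewrite ler_wpM2l ?Dm0// ler_nat.
    case: (boolP (c < h <= M u)) => // /andP[_ hu].
    rewrite lt0b inE/= in_itv/= (Xf_ge_left hab)//=.
    by apply: le_lt_trans uv; exact: Xf_le.
  rewrite ler_wpM2l ?Dp0// ler_nat.
  case: (boolP (c <= h < M u)) => // /andP[_ hu].
  rewrite lt0b inE/= in_itv/=; have /andP[-> _] := Xif_itv hab hcd.
  by apply: le_lt_trans uv; exact: (Xif_le hab hM).
Qed.

End ImageMeasure.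

(** By uniqueness [muL] may be replaced on [[a, b]] by the sum of the image of [mu1] and the two
    atomic measures; the integral of a nonnegative function is additive in the measure. *)
Lemma ge0_substitution f : measurable_fun `[a, b]%classic f ->
  (forall x, `[a, b]%classic x -> 0 <= f x) ->
  (\int[muL]_(x in `[a, b]%classic) (f x)%:E
   = \int[mu1]_(y in `[c, d]%classic) (f (X y))%:E
     + \esum_(h in H) (f (X h) * Dm h)%:E
     + \esum_(h in H) (f (Xi h) * Dp h)%:E)%E.
Proof.
move=> mf f0.
have mab : measurable `[a, b]%classic by exact: measurable_itv.
have cH := countable_Hset hM.
have [nu nuE] := pushforward_measure_exists mu1 mX'.
have [mm mmE] := atomic_measure_exists X cH Dm0.
have [mp mpE] := atomic_measure_exists Xi cH Dp0.
have atomE (m : {measure set R -> \bar R}) w phi :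
    (forall (D : set R) (g : R -> \bar R), measurable D -> measurable_fun D g ->
       (forall x, D x -> (0 <= g x)%E) -> (forall h, H h -> D (phi h)) ->
     (\int[m]_(x in D) g x = \esum_(h in H) ((w h)%:E * g (phi h)))%E) ->
    forall A, measurable A -> (m A = \esum_(h in H) (w h * \1_A (phi h))%:E)%E.
  move=> mE A mA; rewrite -[A in LHS]setIT -integral_indic// mE//.
  - by apply/measurable_EFinP; exact: measurable_indic.
have sq := image_measure_squeeze nuE (atomE _ _ _ mmE) (atomE _ _ _ mpE).
rewrite (eq_measure_integral _ (LS_squeeze_unique hmuL sq)).
have mfE : measurable_fun `[a, b]%classic (EFin \o f) by exact/measurable_EFinP.
have fE0 x : `[a, b]%classic x -> (0 <= (EFin \o f) x)%E.
  by move=> xab; rewrite lee_fin f0.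
rewrite ge0_integral_measure_add// ge0_integral_measure_add//.
congr (_ + _ + _)%E.
- rewrite nuE ge0_integral_pushforward//; last by move=> x; rewrite inE; exact: fE0.
  have -> : X' @^-1` `[a, b]%classic = `[c, d]%classic.
    apply/seteqP; split => y /=; rewrite !in_itv/=; first exact: X'_itv.
    by move=> ycd; rewrite X'E// (Xf_itv hab).
  by apply: eq_integral => y; rewrite inE/= in_itv/= => ycd; rewrite X'E.
- rewrite (mmE _ _ mab mfE fE0); first by apply: eq_esum => h _; rewrite -EFinM mulrC.
  by move=> h /Hitv hcd; rewrite /= in_itv/= Xf_itv.
- rewrite (mpE _ _ mab mfE fE0); first by apply: eq_esum => h _; rewrite -EFinM mulrC.
  by move=> h /Hitv hcd; rewrite /= in_itv/= Xif_itv.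
Qed.

Lemma integral_Xf_Xif f : measurable_fun `[a, b]%classic f ->
  (\int[mu1]_(y in `[c, d]%classic) (f (X y))%:E
   = \int[mu1]_(y in `[c, d]%classic) (f (Xi y))%:E)%E.
Proof.
move=> mf; have mab : measurable `[a, b]%classic by exact: measurable_itv.
apply: ae_eq_integral.
- exact: measurable_itv.
- apply/measurable_EFinP; apply: (measurable_comp mab) => //.
    by move=> _ [y + <-] /=; rewrite !in_itv/=; exact: Xf_itv.
  apply: nondecreasing_itv_measurable => y1 y2 _.
  by rewrite inE/= in_itv/= => y2cd y12; exact: (Xf_nondecreasing hab).
- apply/measurable_EFinP; apply: (measurable_comp mab) => //.
    by move=> _ [y + <-] /=; rewrite !in_itv/=; exact: Xif_itv.
  apply: nondecreasing_itv_measurable => y1 y2.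
  by rewrite inE/= in_itv/= => y1cd _ y12; exact: (Xif_nondecreasing hab).
- have nH := countable_negligible (countable_Hset hM) (mu1_Hset1 hN hmu1).
  apply: negligibleS nH => y /= /not_implyP[]; rewrite in_itv/= => ycd neq.
  by apply: (Hset_of_Xf_neq_Xif hab hM) => //; apply/eqP => e; apply: neq; rewrite e.
Qed.

End Substitution.

(** * From nonnegative to bounded functions *)

Lemma sum_overZr (R : realType) (H : set R) (g w : R -> R) :
  (forall h, H h -> 0 <= w h) ->
  sum_over H (fun h => g h * w h)
  = (\esum_(h in H) (g^\+ h * w h)%:E - \esum_(h in H) (g^\- h * w h)%:E)%E.
Proof.
move=> w0; rewrite /sum_over; congr (_ - _)%E; apply: eq_esum => h /w0 wh.
  by rewrite /funrpos maxr_pMl// mul0r.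
by rewrite /funrneg maxr_pMl// mul0r mulNr.
Qed.

(** Nonnegative terms with a finite sum are all real, so no [oo - oo] arises and the identity is one
    between reals. *)
Lemma subeACA_fin (R : realType) (p1 p2 p3 q1 q2 q3 : \bar R) :
  (0 <= p1)%E -> (0 <= p2)%E -> (0 <= p3)%E ->
  (0 <= q1)%E -> (0 <= q2)%E -> (0 <= q3)%E ->
  (p1 + p2 + p3 < +oo)%E -> (q1 + q2 + q3 < +oo)%E ->
  ((p1 + p2 + p3) - (q1 + q2 + q3) = (p1 - q1) + (p2 - q2) + (p3 - q3))%E.
Proof.
case: p1 p2 p3 q1 q2 q3 => [p1| |] [p2| |] [p3| |] [q1| |] [q2| |] [q3| |] //.
by move=> _ _ _ _ _ _ _ _; rewrite -!(EFinD, EFinB); congr _%:E; ring.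
Qed.

Unset Implicit Arguments.

Theorem mainTheorem3 (R : realType) (a b : R) (M N : R -> R)
  (hab : a < b)
  (hM : {in `[a, b]%classic &, {homo M : x y / x <= y}})
  (hN : {in `[M a, M b]%classic &, {homo N : x y / x <= y}})
  (muL mu1 : {measure set R -> \bar R})
  (hmuL : is_LS_measure (N \o M) a b muL)
  (hmu1 : is_LS_measure (N1 a b M N) (M a) (M b) mu1)
  (f : R -> R)
  (hfm : measurable_fun `[a, b]%classic f)
  (hfb : exists K : R, forall x, `[a, b]%classic x -> `|f x| <= K) :
  (\int[muL]_(x in `[a, b]%classic) (f x)%:E
     = \int[mu1]_(y in `[M a, M b]%classic) (f (Xf a b M y))%:E
       + sum_over (Hset a b M) (fun y => (f (Xf a b M y) * jump_minus N (M a) y)%R)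
       + sum_over (Hset a b M) (fun y => (f (Xif a b M y) * jump_plus N (M b) y)%R))%E
  /\
  (\int[mu1]_(y in `[M a, M b]%classic) (f (Xf a b M y))%:E
     = \int[mu1]_(y in `[M a, M b]%classic) (f (Xif a b M y))%:E)%E.
Proof.
have cd := nondecreasing_ends hab hM.
have sqL : LS_squeeze (N \o M) a b muL.
  apply: is_LS_measure_squeeze hmuL; first exact: ltW.
  move=> x y; rewrite !inE/= !in_itv/= => /andP[ax xb] /andP[ay yb] xy.
  by apply: (nondecreasing_in hN); apply: (nondecreasing_in hM).
have sq1 := is_LS_measure_squeeze cd (N1_nondecreasing hN) hmu1.
split; last exact: (integral_Xf_Xif hab hM hN sq1).
have Dm0 h : Hset a b M h -> 0 <= jump_minus N (M a) h.
  by move=> /Hset_sub/=; rewrite in_itv/= => /andP[? ?]; exact: (jump_minus_ge0 hN).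
have Dp0 h : Hset a b M h -> 0 <= jump_plus N (M b) h.
  by move=> /Hset_sub/=; rewrite in_itv/= => /andP[? ?]; exact: (jump_plus_ge0 hN).
have mab : measurable `[a, b]%classic by exact: measurable_itv.
(* The formula is applied to the positive and negative parts of [f] separately, then subtracted. *)
have Epos := ge0_substitution hab hM hN sqL sq1 (measurable_funrpos hfm)
  (fun x _ => funrpos_ge0 f x).
have Eneg := ge0_substitution hab hM hN sqL sq1 (measurable_funrneg hfm)
  (fun x _ => funrneg_ge0 f x).
(* A bound [K] on [f] and the finite total mass of [muL] make both integrals finite, which the
   subtraction requires. *)
have fin (g : R -> R) : measurable_fun `[a, b]%classic g -> (forall x, 0 <= g x) ->
    (forall x, g x <= `|f x|) ->
    (\int[muL]_(x in `[a, b]%classic) (g x)%:E < +oo)%E.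
  have [K fK] := hfb; have [tot _ _] := sqL => mg g0 gf.
  apply: (@le_lt_trans _ _ (\int[muL]_(x in `[a, b]%classic) K%:E)%E).
    apply: ge0_le_integral => //.
    - by move=> x _; rewrite lee_fin.
    - exact/measurable_EFinP.
    - by move=> x xab; rewrite lee_fin (le_trans (gf x))// fK.
  by rewrite integral_cst// tot -EFinM ltry.
have finpos : (\int[muL]_(x in `[a, b]%classic) (f^\+ x)%:E < +oo)%E.
  apply: fin => [|x|x]; [exact: measurable_funrpos|exact: funrpos_ge0|].
  by rewrite /funrpos ge_max ler_norm normr_ge0.
have finneg : (\int[muL]_(x in `[a, b]%classic) (f^\- x)%:E < +oo)%E.
  apply: fin => [|x|x]; [exact: measurable_funrneg|exact: funrneg_ge0|].
  by rewrite /funrneg ge_max normr_ge0 -normrN ler_norm.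
(* As the jumps are nonnegative, the positive and negative parts of each summand come from those of
   [f] alone, which matches [Epos] and [Eneg]. *)
rewrite (sum_overZr (fun h => f (Xf a b M h)) Dm0).
rewrite (sum_overZr (fun h => f (Xif a b M h)) Dp0).
rewrite integralE [X in (_ = X + _ + _)%E]integralE.
have EposE (mu : {measure set R -> \bar R}) (D : set R) (g : R -> R) :
   (\int[mu]_(x in D) ((fun x => (g x)%:E)^\+ x) = \int[mu]_(x in D) (g^\+ x)%:E)%E.
  by apply: eq_integral => x _; exact: (congr1 (@^~ x) (funerpos g)).
have EnegE (mu : {measure set R -> \bar R}) (D : set R) (g : R -> R) :
   (\int[mu]_(x in D) ((fun x => (g x)%:E)^\- x) = \int[mu]_(x in D) (g^\- x)%:E)%E.
  by apply: eq_integral => x _; exact: (congr1 (@^~ x) (funerneg g)).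
rewrite !EposE !EnegE Epos Eneg; rewrite Epos in finpos; rewrite Eneg in finneg.
apply: subeACA_fin => //.
all: try by apply: integral_ge0 => x _; rewrite lee_fin ?funrpos_ge0 ?funrneg_ge0.
all: apply: esum_ge0 => h Hh; rewrite lee_fin mulr_ge0 ?Dm0 ?Dp0//.
all: by rewrite ?funrpos_ge0 ?funrneg_ge0.
Qed.
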